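(* Let $n\ge2$ and let $X_{\cdot,B}$ be a simple (undirected, loopless) quantum graph on $M_n$, i.e. $B\in M_n$ is a real symmetric projector with $B\mathbf 1=0$. Then $\alpha(X_{\cdot,B})\ge\operatorname{EqRows}(B)$.
   Context: $M_n=M_n(\mathbb C)$; ''projector'' means orthogonal projector; $\mathbf 1\in\mathbb C^n$ is the all-ones vector. $X_{\cdot,B}$ is the quantum graph on $M_n$ with adjacency operator the Schur multiplier $x\mapsto (B_{ij}x_{ij})_{i,j}$; its operator space is $S=\{\operatorname{diag}(v): v\in\operatorname{img}B\}\subseteq M_n$. A $k$-independent set of a quantum graph with operator space $S$ is a projector $P\in M_n$ of rank $k$ with $PSP\subseteq\mathbb CP$; the independence number $\alpha$ is the largest $k$ for which a $k$-independent set exists. $\operatorname{EqRows}(B)$ is the largest $k$ such that there exist $j_1<\dots<j_k$ in $\{1,\dots,n\}$ for which the rows of $B$ (in the standard basis) indexed by $j_1,\dots,j_k$ are all equal. *)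

(* Defs.v *)
From HB Require Import structures.
From mathcomp Require Import all_boot all_order all_algebra.
From mathcomp Require Import all_classical all_reals.
From mathcomp Require Export complex.

Set Implicit Arguments.
Unset Strict Implicit.
Unset Printing Implicit Defensive.

Import Order.TTheory GRing.Theory Num.Theory.
Local Open Scope classical_set_scope.
Local Open Scope ring_scope.

(* Orthogonal projector: a self-adjoint idempotent. *)
Definition is_projector (R : realType) (n : nat) (P : 'M[R[i]]_n) : Prop :=
  P \is hermsymmx /\ P *m P = P.

(* X_{.,B} is the quantum graph on M_n whose adjacency operator is the Schur
   multiplier by B. *)
Definition schur_mul (R : realType) (n : nat) (B x : 'M[R[i]]_n) : 'M[R[i]]_n :=
  \matrix_(i, j) (B i j * x i j).

(* Operator space of X_{.,B}; [diag_mx] expects a row vector, whence [v^T]. *)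
Definition op_space (R : realType) (n : nat) (B : 'M[R[i]]_n) :
    set 'M[R[i]]_n :=
  [set diag_mx v^T | v in range (fun w : 'cV[R[i]]_n => B *m w)].

(* In general the operator space of a quantum graph on M_n with adjacency
   operator A is the range of T |-> \sum_(i, j) A(e_ij) T e_ji: if
   A(x) = \sum_k K_k x K_k^*, this map sends T to \sum_k tr(K_k^* T) K_k.
   For the Schur multiplier by B it is the space above. *)
Lemma op_spaceE (R : realType) (n : nat) (B : 'M[R[i]]_n) :
  op_space B =
  range (fun T : 'M[R[i]]_n =>
    \sum_i \sum_j schur_mul B (delta_mx i j) *m T *m delta_mx j i).
Proof.
have E (T : 'M[R[i]]_n) :
    \sum_i \sum_j schur_mul B (delta_mx i j) *m T *m delta_mx j i =
    diag_mx (B *m (\col_j T j j))^T.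
  have S i j : schur_mul B (delta_mx i j) = B i j *: delta_mx i j.
    apply/matrixP=> a b; rewrite !mxE.
    by have [/andP[/eqP-> /eqP->]|_] := boolP ((a == i) && (b == j));
      rewrite ?mulr1 ?mulr0.
  have D i j : delta_mx i j *m T *m delta_mx j i = T j j *: delta_mx i i.
    apply/matrixP=> a b; rewrite !mxE (bigD1 j) //= big1 ?addr0; last first.
      by move=> k kj; rewrite [X in _ * X]mxE (negbTE kj) mulr0.
    rewrite !mxE (bigD1 j) //= big1 ?addr0; last first.
      by move=> k kj; rewrite mxE (negbTE kj) andbF mul0r.
    by rewrite !mxE !eqxx andbT /= mulrAC -natrM mulnb mulrC.
  apply/matrixP=> a b; rewrite summxE (bigD1 a) //= [X in _ + X]big1 ?addr0.
    rewrite summxE !mxE -sumrMnl; apply: eq_bigr => j _.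
    by rewrite S -!scalemxAl D !mxE eqxx mulrA mulr_natr eq_sym.
  move=> i ia; rewrite summxE big1 // => j _.
  by rewrite S -!scalemxAl D !mxE eq_sym (negbTE ia) !mulr0.
apply/seteqP; split=> [_ [_ [w _ <-] <-]|_ [T _ <-]] /=.
  exists (diag_mx w^T) => //; rewrite E; congr (diag_mx (B *m _)^T).
  by apply/colP=> j; rewrite !mxE eqxx.
by rewrite E; exists (B *m \col_j T j j) => //; exists (\col_j T j j).
Qed.

Definition is_independent (R : realType) (n : nat) (S : set 'M[R[i]]_n)
    (k : nat) (P : 'M[R[i]]_n) : Prop :=
  [/\ is_projector P, \rank P = k &
      forall s, S s -> exists c : R[i], P *m s *m P = c *: P].

(* The largest k <= n satisfying Q (0 if there is none). Both uses below only
   admit k <= n and hold at k = 0, so the value is the true maximum; see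
   [indep_numberP] and [EqRowsP]. *)
Definition largest (n : nat) (Q : nat -> Prop) : nat :=
  (\max_(k < n.+1 | `[< Q k >]) k)%N.

Lemma largestP (n : nat) (Q : nat -> Prop) :
  Q 0%N -> (forall k, Q k -> (k <= n)%N) ->
  Q (largest n Q) /\ (forall k, Q k -> (k <= largest n Q)%N).
Proof.
move=> Q0 Qn; split=> [|k Qk].
  have -> : largest n Q = (\max_(k in [pred k : 'I_n.+1 | `[< Q k >]]) k)%N by [].
  have [|i Qi ->] := @eq_bigmax_cond _ [pred k : 'I_n.+1 | `[< Q k >]] val.
    by apply/card_gt0P; exists ord0; apply/asboolP.
  exact/asboolP.
apply: (leq_bigmax_cond (F := val) (Ordinal (Qn k Qk : (k < n.+1)%N))); exact/asboolP.
Qed.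

(* The independence number of a quantum graph with operator space S. *)
Definition indep_number (R : realType) (n : nat) (S : set 'M[R[i]]_n) : nat :=
  largest n (fun k => exists P, is_independent S k P).

Definition has_eq_rows (R : realType) (n : nat) (B : 'M[R[i]]_n) (k : nat) :
    Prop :=
  exists j : 'I_k -> 'I_n,
    (forall a b : 'I_k, (a < b)%N -> (j a < j b)%N) /\
    (forall a b : 'I_k, row (j a) B = row (j b) B).

Definition EqRows (R : realType) (n : nat) (B : 'M[R[i]]_n) : nat :=
  largest n (has_eq_rows B).

Lemma indep_numberP (R : realType) (n : nat) (S : set 'M[R[i]]_n) :
  (exists P, is_independent S (indep_number S) P) /\
  (forall k P, is_independent S k P -> (k <= indep_number S)%N).
Proof.
have [|k [P [_ <- _]]|H1 H2] :=
  @largestP n (fun k => exists P, is_independent S k P).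
- exists 0; split; rewrite ?mxrank0 //.
    split; last by rewrite mulmx0.
    by apply/is_hermitianmxP; rewrite trmx0 map_mx0 scaler0.
  by move=> s _; exists 0; rewrite mulmx0 scaler0.
- exact: rank_leq_row.
- by split=> // k P kP; apply: H2; exists P.
Qed.

Lemma EqRowsP (R : realType) (n : nat) (B : 'M[R[i]]_n) :
  has_eq_rows B (EqRows B) /\
  (forall k, has_eq_rows B k -> (k <= EqRows B)%N).
Proof.
apply: largestP => [|k [j [jlt _]]].
  have f (a : 'I_0) : 'I_n by case: a.
  by exists f; split=> -[].
have jinj : injective j.
  move=> a b jab; apply/val_inj; case: (ltngtP a b) => // /jlt;
  by rewrite jab ltnn.
by have := leq_card j jinj; rewrite !card_ord.
Qed.

(* Main.v *)
Require Import Defs.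
From mathcomp Require Import all_boot all_order all_algebra.
From mathcomp Require Import all_classical all_reals.
Import GRing.Theory.
Local Open Scope ring_scope.

(** If the rows of [B] indexed by [j_1 < ... < j_k] are equal, every vector of
    [img B] is constant on these indices, so the coordinate projector onto them
    compresses every [diag(v)], [v \in img B], to a scalar. *)

Lemma compress_diag_mx {F : fieldType} {n k : nat} (j : 'I_k -> 'I_n)
    (d : 'rV[F]_n) (c : F) :
  injective j -> (forall a, d 0 (j a) = c) ->
  rowsub j 1%:M *m diag_mx d *m (rowsub j 1%:M)^T = c%:M.
Proof.
move=> j_inj dj; rewrite trmx_mxsub trmx1 mul_rowsub_mx mul1mx.
rewrite mulmx_colsub mulmx1.
(* What remains is the submatrix of [diag_mx d] on the indices [j a]; injectivity of [j] makes its
   off-diagonal entries vanish. *)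
by apply/matrixP=> a b; rewrite !mxE (inj_eq j_inj) dj.
Qed.

Lemma rowsub1_mul_tr (F : fieldType) {n k : nat} (j : 'I_k -> 'I_n) :
  injective j -> rowsub j 1%:M *m (rowsub j 1%:M)^T = 1%:M :> 'M[F]_k.
Proof.
move=> j_inj; have := compress_diag_mx j (const_mx 1) (1 : F) j_inj.
by rewrite diag_const_mx mulmx1; apply=> a; rewrite mxE.
Qed.

(* [\rank (M^T *m M) >= \rank (M *m M^T *m M *m M^T) = \rank 1 = k] *)
Lemma mxrank_tr_mul {F : fieldType} {n k : nat} (M : 'M[F]_(k, n)) :
  M *m M^T = 1%:M -> \rank (M^T *m M) = k.
Proof.
move=> MMt; apply/eqP; rewrite eqn_leq.
rewrite (leq_trans (mxrankM_maxr _ _) (rank_leq_row _)) /=.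
have MPMt : M *m (M^T *m M) *m M^T = 1%:M by rewrite mulmxA MMt mul1mx.
have := leq_trans (mxrankM_maxl (M *m (M^T *m M)) M^T) (mxrankM_maxr _ _).
by rewrite MPMt mxrank1.
Qed.

Lemma eq_rows_independent (R : realType) (n k : nat) (B : 'M[R[i]]_n) :
  has_eq_rows B k -> exists P, is_independent (op_space B) k P.
Proof.
case=> j [j_lt Bj].
have j_inj : injective j.
  move=> a b jab; apply/val_inj; case: (ltngtP a b) => // /j_lt;
  by rewrite jab ltnn.
set M : 'M[R[i]]_(k, n) := rowsub j 1%:M.
have MMt : M *m M^T = 1%:M by exact: rowsub1_mul_tr.
(* This is the coordinate projector, factored through dimension [k] so that each requirement reduces
   to a [k] by [k] identity. *)
exists (M^T *m M); split.
- split; last by rewrite mulmxA -(mulmxA M^T) MMt mulmx1.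
  (* Conjugation fixes [M], a submatrix of the identity. *)
  apply/is_hermitianmxP; rewrite expr0 scale1r trmx_mul trmxK map_mxM.
  by rewrite -map_trmx /M map_mxsub map_mx1.
- exact: mxrank_tr_mul.
move=> _ [_ [w _ <-] <-].
have [c cE] : exists c, forall a, (B *m w)^T 0 (j a) = c.
  (* For [k = 0] there is no entry to read [c] from, and any scalar works. *)
  case: k => [|k] in j Bj {j_lt j_inj M MMt} *; first by exists 0; case.
  exists ((B *m w)^T 0 (j 0)) => a.
  by have /rowP/(_ 0) := congr1 (mulmxr w) (Bj a 0); rewrite /= -!row_mul !mxE.
(* Regrouping isolates the inner block [M *m diag_mx _ *m M^T], which is [c%:M]. *)
exists c; rewrite !mulmxA -2!(mulmxA M^T).
by rewrite (compress_diag_mx _ _ _ j_inj cE) mul_mx_scalar -scalemxAl.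
Qed.

Theorem corollary4p31 (R : realType) (n : nat) (hn : (2 <= n)%N)
    (B : 'M[R[i]]_n)
    (hreal : B \is a mxOver Num.real)
    (hsym : B^T = B)
    (hproj : is_projector B)
    (hloopless : B *m (const_mx 1 : 'cV[R[i]]_n) = 0) :
  (EqRows B <= indep_number (op_space B))%N.
Proof.
have [/eq_rows_independent [P indepP] _] := EqRowsP B.
by have [_ max_indep] := indep_numberP (op_space B); apply: max_indep indepP.
Qed.
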